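(* Let $X$ be an $n$-dimensional real linear space and let $w : X \to \mathbb{R}$ be a convex function with $\int_X e^{-w} < \infty$. Let $p > 0$. Define $h : X \to \mathbb{R}$ by $h(0) = 0$ and, for $0 \neq x \in X$, $$ h(x) = \left( \int_0^{\infty} e^{-w(s x)} s^{p-1}\, ds \right)^{-1/p}. $$ Then $h$ is a convex function on $X$.
   Context: The integral $\int_X e^{-w}$ is taken with respect to Lebesgue measure on $X$ (obtained from any linear identification of $X$ with $\mathbb{R}^n$; the finiteness condition does not depend on the identification). *)

(* Defs.v *)
From HB Require Import structures.
From mathcomp Require Import all_boot all_order all_algebra.
From mathcomp Require Import all_classical all_reals all_analysis.

Set Implicit Arguments.
Unset Strict Implicit.
Unset Printing Implicit Defensive.

Import Order.TTheory GRing.Theory Num.Theory.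
Import numFieldNormedType.Exports.

Local Open Scope classical_set_scope.
Local Open Scope ring_scope.

Definition cons_pair (R : realType) (n : nat)
    (z : measurableTypeR R * n.-tuple (measurableTypeR R)) :
  n.+1.-tuple (measurableTypeR R) := [tuple of z.1 :: z.2].

(* Lebesgue measure on R^n, on the product (i.e. Borel) sigma-algebra of
   n.-tuple R: the iterated product of the one-dimensional measure (a point
   mass for n = 0). *)
Fixpoint lebesgue_tuple (R : realType) (n : nat) :
    set (n.-tuple (measurableTypeR R)) -> \bar R :=
  match n with
  | 0 => dirac [tuple]
  | n'.+1 => pushforward
      (product_measure1 (@lebesgue_measure R) (@lebesgue_tuple R n'))
      (@cons_pair R n')
  end.

Section lebesgue_tuple_measure.
Context (R : realType).
Local Notation RR := (measurableTypeR R).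

Let uncons n (t : n.+1.-tuple RR) : RR * n.-tuple RR :=
  (tnth t ord0, [tuple of behead t]).

Let measurable_cons_pair n : measurable_fun setT (@cons_pair R n).
Proof. exact: measurable_cons. Qed.

Let measurable_uncons n : measurable_fun setT (@uncons n).
Proof.
apply/measurable_fun_pair; first exact: measurable_tnth.
exact: measurable_behead.
Qed.

Let cons_pairK n : cancel (@cons_pair R n) (@uncons n).
Proof. by case=> a t; congr pair; exact/val_inj. Qed.

Section step.
Variables (n : nat) (m : {sigma_finite_measure set (n.-tuple RR) -> \bar R}).

Let p := product_measure1 (@lebesgue_measure R) m.

Let step := pushforward p (@cons_pair R n).

Let step0 : step set0 = 0%E.
Proof. by rewrite /step /pushforward preimage_set0 /p measure0. Qed.

Let step_ge0 A : (0 <= step A)%E.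
Proof. by rewrite /step /pushforward /p; exact: measure_ge0. Qed.

Let step_sigma_additive : semi_sigma_additive step.
Proof.
move=> F mF tF mUF; rewrite /step /pushforward preimage_bigcup /p.
have mpre B : measurable B -> measurable (@cons_pair R n @^-1` B).
  by move=> mB; rewrite -[X in measurable X]setTI; exact: measurable_cons_pair.
apply: (@measure_semi_sigma_additive _ _ _ (product_measure1 (@lebesgue_measure R) m)).
- by move=> k; exact: (mpre _ (mF k)).
- apply/trivIsetP => /= i j _ _ ij; rewrite -preimage_setI.
  by move/trivIsetP : tF => /(_ i j I I ij) ->; rewrite preimage_set0.
- by rewrite -preimage_bigcup; exact: (mpre _ mUF).
Qed.

HB.instance Definition _ := isMeasure.Build _ _ _ step
  step0 step_ge0 step_sigma_additive.

Let step_sigma_finite : sigma_finite setT step.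
Proof.
have /sigma_finiteP[F [FT ndF Foo]] := sigma_finiteT (@lebesgue_measure R).
have /sigma_finiteP[G [GT ndG Goo]] := sigma_finiteT m.
exists (fun k => @uncons n @^-1` (F k `*` G k)).
  rewrite -preimage_bigcup (_ : \bigcup_k _ = setT) ?preimage_setT//.
  rewrite -setXTT FT GT predeqE => -[x y]; split.
    by move=> [k _ []/= ? ?]; split; exists k.
  move=> [/= [k _ Fkx] [l _ Gly]]; exists (maxn k l) => //; split.
  - by move: x Fkx; exact/subsetPset/ndF/leq_maxl.
  - by move: y Gly; exact/subsetPset/ndG/leq_maxr.
move=> k; have [mF Fk] := Foo k; have [mG Gk] := Goo k; split.
  by rewrite -[X in measurable X]setTI; apply: measurable_uncons => //; exact: measurableX.
rewrite /step /pushforward -comp_preimage.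
rewrite (_ : _ \o _ = id); last by apply/funext => z /=; rewrite cons_pairK.
by rewrite preimage_id /p product_measure1E// lte_mul_pinfty// ge0_fin_numE.
Qed.

HB.instance Definition _ := Measure_isSigmaFinite.Build _ _ _ step
  step_sigma_finite.

Lemma lebesgue_tuple_step :
  exists m' : {sigma_finite_measure set (n.+1.-tuple RR) -> \bar R},
    m' = step :> (set _ -> \bar R).
Proof. by exists step. Qed.

End step.

Let lebesgue_tuple_ex n :
  exists m : {sigma_finite_measure set (n.-tuple RR) -> \bar R},
    m = @lebesgue_tuple R n :> (set _ -> \bar R).
Proof.
elim: n => [|n [m mE]]; first by exists (\d_([tuple] : 0.-tuple RR)).
by have [m' m'E] := lebesgue_tuple_step m; exists m'; rewrite m'E mE.
Qed.

Variable n : nat.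
Local Notation leb := (@lebesgue_tuple R n).

Let leb0 : leb set0 = 0%E.
Proof. by have [m <-] := lebesgue_tuple_ex n; exact: measure0. Qed.

Let leb_ge0 A : (0 <= leb A)%E.
Proof. by have [m <-] := lebesgue_tuple_ex n; exact: measure_ge0. Qed.

Let leb_sigma_additive : semi_sigma_additive leb.
Proof.
by have [m <-] := lebesgue_tuple_ex n; exact: measure_semi_sigma_additive.
Qed.

HB.instance Definition _ := isMeasure.Build _ _ _ leb
  leb0 leb_ge0 leb_sigma_additive.

Let leb_sigma_finite : sigma_finite setT leb.
Proof. by have [m <-] := lebesgue_tuple_ex n; exact: sigma_finiteT. Qed.

HB.instance Definition _ := Measure_isSigmaFinite.Build _ _ _ leb
  leb_sigma_finite.

End lebesgue_tuple_measure.

Lemma lebesgue_tuple_box (R : realType) (n : nat)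
    (A : 'I_n -> set (measurableTypeR R)) : (forall i, measurable (A i)) ->
  lebesgue_tuple [set t | forall i, A i (tnth t i)] =
  (\prod_(i < n) lebesgue_measure (A i))%E.
Proof.
elim: n A => [|n IHn] A mA.
  rewrite big_ord0 /= diracE mem_set// => -[].
  by [].
rewrite big_ord_recl -IHn// -product_measure1E//; last first.
  rewrite (_ : [set _ | _] = \bigcap_(i in [set: 'I_n])
    ((fun t : n.-tuple (measurableTypeR R) => tnth t i) @^-1` A (lift ord0 i))).
    apply: fin_bigcap_measurable => // i _.
    by rewrite -[X in measurable X]setTI; exact: measurable_tnth.
  by apply/seteqP; split => [t At i _|t At i]; [exact: At|exact: (At i)].
congr product_measure1; apply/seteqP; split => -[a t] /=.
  move=> At; split; first exact: (At ord0).
  by move=> i; have := At (lift ord0 i); rewrite tnthS.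
move=> [Aa At] i; have [->//|] := eqVneq i ord0.
by case: (unliftP ord0 i) => [j ->|->]; rewrite ?eqxx// => _; rewrite tnthS.
Qed.

Section radial.
Context (R : realType) (X : vectType R).

(* \int_X f for the Lebesgue measure that X receives from the linear
   identification phi with R^n. *)
Definition integral_via (n : nat) (phi : 'rV[R]_n -> X) (f : X -> \bar R) :=
  (\int[@lebesgue_tuple R n]_t f (phi (\row_(i < n) tnth t i)))%E.

(* The integral is an element of [0, +oo]; if it is +oo, both fine and the
   negative power below give the expected value h x = 0. *)
Definition ray_gauge (w : X -> R) (p : R) (x : X) : R :=
  if x == 0 then 0 else
  (fine (\int[lebesgue_measure]_(s in `]0%R, +oo[)
           (expR (- w (s *: x)) * s `^ (p - 1))%:E)%E) `^ (- p^-1).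

End radial.

(* Main.v *)
(* Convexity of h amounts to h (u x + v y) <= u h x + v h y for u, v > 0.  Put
   f r = e^{-w(r x)} r^{p-1}, g s = e^{-w(s y)} s^{p-1}, with integrals A and B
   over compact subintervals of (0, oo), and let s = S r be the monotone map
   transporting f dr / A to g ds / B.  With t = r s / (u s + v r) one has
   t (u x + v y) = l (r x) + m (s y) for l = u s / (u s + v r), m = 1 - l, so that
   convexity of w bounds e^{-w(t (u x + v y))} from below.  Substituting t for r
   in the integral for u x + v y and applying the weighted AM-GM inequality
   twice bounds it below by (u A^{-1/p} + v B^{-1/p})^{-p}.  The compact
   subintervals are then exhausted, which also covers infinite integrals. *)

Require Import Defs.
From mathcomp Require Import all_boot all_order all_algebra.
From mathcomp Require Import all_classical all_reals all_analysis.
From mathcomp Require Import measurable_realfun ring lra.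

Set Implicit Arguments.
Unset Strict Implicit.
Unset Printing Implicit Defensive.

Import Order.TTheory GRing.Theory Num.Theory.
Import numFieldNormedType.Exports.
Local Open Scope classical_set_scope.
Local Open Scope ring_scope.

(** * One-variable calculus: convex functions, antiderivatives, local inverses *)

(** Convexity bounds the increments at [x] from above by a chord and from below by a reflected
    chord. Together they give [|f (x + e * y) - f x| <= e * M] for [y = 1] and [y = -1], a Lipschitz
    estimate at [x]. *)
Lemma convex_continuous (R : realType) (f : R -> R) :
  (forall x y a b, 0 < a -> 0 < b -> a + b = 1 ->
    f (a * x + b * y) <= a * f x + b * f y) ->
  continuous f.
Proof.
move=> cf x.
pose M := `|f (x + 1) - f x| + `|f (x - 1) - f x|.
have chord y e : 0 < e -> e < 1 ->
    f (x + e * y) - f x <= e * (f (x + y) - f x).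
  move=> e0 e1.
  have := cf (x + y) x e (1 - e) e0.
  rewrite subr_gt0 => /(_ e1)/(_ ltac:(ring)).
  have -> : e * (x + y) + (1 - e) * x = x + e * y by ring.
  lra.
(* The lower bound comes from writing [x] as a convex combination of [x - y] and [x + e * y], with
   weights [e / (1 + e)] and [1 / (1 + e)]. *)
have reflect y e : 0 < e -> e < 1 ->
    f x - f (x + e * y) <= e * (f (x - y) - f x).
  move=> e0 e1.
  have := cf (x - y) (x + e * y) (e / (1 + e)) (1 / (1 + e)).
  have e10 : 1 + e != 0 by apply: lt0r_neq0; lra.
  rewrite !divr_gt0; [|lra..].
  move=> /(_ isT isT) /(_ ltac:(by field)).
  have -> : e / (1 + e) * (x - y) + 1 / (1 + e) * (x + e * y) = x.
    by field.
  move=> h.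
  have : (1 + e) * f x <= e * f (x - y) + f (x + e * y).
    rewrite -ler_pdivlMl; last lra.
    by rewrite (le_trans h)// le_eqVlt; apply/orP; left; apply/eqP; field.
  lra.
have bound e y : 0 < e -> e < 1 -> (y == 1) || (y == -1) ->
    `|f (x + e * y) - f x| <= e * M.
  move=> e0 e1 hy.
  have Mb : f (x + y) - f x <= M /\ f (x - y) - f x <= M.
    have := ler_norm (f (x + 1) - f x).
    have := ler_norm (f (x - 1) - f x).
    have := normr_ge0 (f (x + 1) - f x).
    have := normr_ge0 (f (x - 1) - f x).
    rewrite /M; case/orP: hy => /eqP ->; rewrite ?opprK; split; lra.
  have [M1 M2] := Mb.
  rewrite ler_norml; apply/andP; split.
    rewrite lerNl opprB (le_trans (reflect y e e0 e1))// ler_wpM2l// ltW//.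
  by rewrite (le_trans (chord y e e0 e1))// ler_wpM2l// ltW.
have M0 : 0 <= M by rewrite addr_ge0.
have near_x e : 0 < e -> \forall z \near x, `|x - z| < e.
  by move=> e0; exact: (nbhsx_ballx x e e0).
apply/cvgrPdist_le => eps eps0.
near=> z.
have [->|zx] := eqVneq z x; first by rewrite subrr normr0 ltW.
have zx1 : `|z - x| < 1 by rewrite distrC; near: z; exact: near_x.
(* The summand 1 keeps the denominator positive when [M = 0]. *)
have zxe : `|z - x| < eps / (M + 1).
  by rewrite distrC; near: z; apply: near_x; rewrite divr_gt0// ltr_wpDl.
have -> : z = x + `|z - x| * Num.sg (z - x).
  by rewrite mulrC -numEsg subrKC.
rewrite distrC.
apply: (le_trans (bound _ _ _ _ _)).
- by rewrite normr_gt0 subr_eq0.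
- by [].
- by rewrite /Num.sg subr_eq0 (negbTE zx); case: ifP; rewrite eqxx ?orbT.
rewrite ltr_pdivlMr in zxe; last by rewrite ltr_wpDl.
apply/ltW/(le_lt_trans _ zxe); rewrite ler_wpM2l//; lra.
Unshelve. all: by end_near. Qed.

Lemma is_derive1_continuous (R : realType) (f : R -> R) (x l : R) :
  is_derive x 1 f l -> {for x, continuous f}.
Proof.
by move=> d; exact/differentiable_continuous/derivable1_diffP/ex_derive.
Qed.

Lemma antiderivative (R : realType) (f : R -> R) (a : R) :
  (forall x, a <= x -> {for x, continuous f}) ->
  exists F : R -> R, forall x, a < x -> is_derive x 1 F (f x).
Proof.
move=> cf.
exists (fun x => \int[lebesgue_measure]_(t in `[a, x]) f t)%R => x ax.
(* The bound [x + 1] only serves to make [x] an interior point; [F] itself does not depend on it. *)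
have [||||d1 d2] := @continuous_FTC1_closed R f a x (x + 1).
- by rewrite ltrDl.
- apply: continuous_compact_integrable; first exact: segment_compact.
  apply/continuous_in_subspaceT => y; rewrite inE/= in_itv/= => /andP[ay _].
  exact: cf.
- exact: ax.
- exact/cf/ltW.
by apply: DeriveDef => //; rewrite -derive1E.
Qed.

Lemma integral_antiderivative (R : realType) (f F : R -> R) (a b : R) :
  a < b -> (forall x, a <= x <= b -> {for x, continuous f}) ->
  (forall x, a <= x <= b -> is_derive x 1 F (f x)) ->
  (\int[lebesgue_measure]_(x in `[a, b]) (f x)%:E = (F b - F a)%:E)%E.
Proof.
move=> ab cf dF.
have cF x : a <= x <= b -> {for x, continuous F}.
  by move=> /dF; exact: is_derive1_continuous.
rewrite (continuous_FTC2 (F := F) ab).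
- by rewrite EFinB.
- apply/continuous_in_subspaceT => y; rewrite inE/= in_itv/=.
  exact: cf.
- split.
  + move=> x; rewrite in_itv/= => /andP[ax xb].
    by have := dF x; rewrite (ltW ax) (ltW xb) => /(_ isT) d; exact: ex_derive.
  + by apply: cvg_at_right_filter; apply: cF; rewrite lexx ltW.
  + by apply: cvg_at_left_filter; apply: cF; rewrite lexx ltW.
- move=> x; rewrite in_itv/= => /andP[ax xb].
  have := dF x; rewrite (ltW ax) (ltW xb) => /(_ isT) d.
  by rewrite derive1E; exact: derive_val.
Qed.

Lemma gt0_is_derive_incr (R : realType) (F f : R -> R) (a b : R) :
  (forall x, a < x < b -> is_derive x 1 F (f x)) ->
  (forall x, a < x < b -> 0 < f x) ->
  {in `]a, b[ &, {homo F : x y / x < y}}.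
Proof.
move=> dF f0 x y; rewrite !in_itv/= => /andP[ax xb] /andP[ay yb] xy.
have [| |c] := @MVT R F f x y xy.
- move=> z; rewrite in_itv/= => /andP[xz zy]; apply: dF.
  by rewrite (lt_trans ax xz) (lt_trans zy yb).
- apply/continuous_in_subspaceT => z; rewrite inE/= in_itv/= => /andP[xz zy].
  have := dF z; rewrite (lt_le_trans ax xz) (le_lt_trans zy yb) => /(_ isT).
  exact: is_derive1_continuous.
- rewrite in_itv/= => /andP[xc cy] e.
  rewrite -subr_gt0 e mulr_gt0 ?subr_gt0// f0//.
  by rewrite (lt_trans ax xc) (lt_trans cy yb).
Qed.

(** A positive derivative makes [F] injective on the open interval, so choosing a preimage there
    (with default 0 off the image) gives a left inverse, to which the inverse function rule applies
    at each point. *)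
Lemma is_derive_local_inverse (R : realType) (F f : R -> R) (a b : R) :
  (forall x, a < x < b -> is_derive x 1 F (f x)) ->
  (forall x, a < x < b -> 0 < f x) ->
  exists G : R -> R, forall x, a < x < b ->
    G (F x) = x /\ is_derive (F x) 1 G (f x)^-1.
Proof.
move=> dF f0.
have incr := gt0_is_derive_incr dF f0.
pose G y := xget 0 [set x | a < x < b /\ F x = y].
have GK x : a < x < b -> G (F x) = x.
  move=> xab; rewrite /G; case: xgetP => [z _ [/= zab zx]|/(_ x)/=]; last first.
    by move=> h; exfalso; exact: h.
  case: (ltgtP z x) => // zx'.
  - by have := incr z x; rewrite !in_itv/= => /(_ zab xab zx'); rewrite zx ltxx.
  - by have := incr x z; rewrite !in_itv/= => /(_ xab zab zx'); rewrite zx ltxx.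
exists G => x /[dup] xab /andP[ax xb]; split; first exact: GK.
have nab : \forall z \near x, a < z < b.
  near=> z; apply/andP; split; near: z; [exact: lt_nbhsr|exact: lt_nbhsl].
apply: (@is_derive_inverse R F G (f x) x).
- by apply: filterS nab => z; exact: GK.
- by apply: filterS nab => z /dF; exact: is_derive1_continuous.
- exact: dF.
- exact/lt0r_neq0/f0.
Unshelve. all: by end_near. Qed.

(** * The density along a ray and the pointwise inequalities of the transport *)

(** Here [phi] stands for the restriction [s -> w (s x)] to a ray; all estimates are made for such
    functions of one variable. *)
Definition ray_density (R : realType) (p : R) (phi : R -> R) (s : R) : R :=
  expR (- phi s) * s `^ (p - 1).

(** AM-GM in exponential form: averaging the tangent line inequality at the mean [z], the linear
    terms cancel. *)
Lemma expR_mean_le (R : realType) (l m x y : R) :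
  0 <= l -> 0 <= m -> l + m = 1 ->
  expR (l * x + m * y) <= l * expR x + m * expR y.
Proof.
move=> l0 m0 lm; pose z := l * x + m * y.
have tangent w : expR z * (1 + (w - z)) <= expR w.
  have -> : expR w = expR z * expR (w - z) by rewrite -expRD subrKC.
  rewrite ler_wpM2l ?expR_ge0//.
  exact: expR_ge1Dx.
have := lerD (ler_wpM2l l0 (tangent x)) (ler_wpM2l m0 (tangent y)).
apply: le_trans; rewrite -/z le_eqVlt; apply/orP; left; apply/eqP.
have -> : l = 1 - m by lra.
have -> : z = (1 - m) * x + m * y by rewrite /z; congr (_ * _ + _); lra.
by ring.
Qed.

(** This is nonnegativity of the entropy of the weights [(l, m)] relative to [(a, b) / (a + b)].
    Each term is bounded by [ln q <= q - 1], and the bounds sum to [1 - 1 = 0]. *)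
Lemma ln_le_relative_entropy (R : realType) (l m a b : R) :
  0 < l -> 0 < m -> l + m = 1 -> 0 < a -> 0 < b ->
  - ln (a + b) <= l * ln (l / a) + m * ln (m / b).
Proof.
move=> l0 m0 lm a0 b0; have ab0 : 0 < a + b by rewrite addr_gt0.
have gibbs k c : 0 < k -> 0 < c ->
    k * (- ln (k / c) - ln (a + b)) <= c / (a + b) - k.
  move=> k0 c0; have kc0 : 0 < k / c by rewrite divr_gt0.
  have q0 : 0 < (c / k) / (a + b) by rewrite !divr_gt0.
  rewrite -lnV ?posrE// invf_div -ln_div ?posrE// ?divr_gt0//.
  have := @le_ln1Dx R (c / k / (a + b) - 1); rewrite subrKC.
  move=> /(_ ltac:(lra)) /(ler_wpM2l (ltW k0)) /le_trans; apply.
  rewrite le_eqVlt; apply/orP; left; apply/eqP; field.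
  by rewrite !gt_eqF.
have h1 := gibbs _ _ l0 a0; have h2 := gibbs _ _ m0 b0.
have e : a / (a + b) + b / (a + b) = 1 by rewrite -mulrDl divff// gt_eqF.
have e' : l * ln (a + b) + m * ln (a + b) = ln (a + b).
  by rewrite -mulrDl lm mul1r.
lra.
Qed.

(** Put [a = u A^(-1/p)] and [b = v B^(-1/p)]. Convexity of the exponential merges the two summands
    and lets [l x + m y] absorb [z]; the entropy inequality, multiplied by [p], then leaves
    [(a + b)^(-p)]. *)
Lemma pointwise_transport_bound (R : realType)
    (p u v A B l m x y z : R) :
  0 < p -> 0 < u -> 0 < v -> 0 < A -> 0 < B -> 0 < l -> 0 < m -> l + m = 1 ->
  z <= l * x + m * y ->
  (u * A `^ (- p^-1) + v * B `^ (- p^-1)) `^ (- p) <=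
  expR (- z) * (l * (l / u) `^ p * A * expR x + m * (m / v) `^ p * B * expR y).
Proof.
move=> p0 u0 v0 A0 B0 l0 m0 lm zxy.
(* The constant [C] moves inside the [p]-th power as the factor [C^(-1/p)] of the denominator. *)
have term k w C c : 0 < k -> 0 < w -> 0 < C ->
    k * (k / w) `^ p * C * expR c =
    k * expR (p * ln (k / (w * C `^ (- p^-1))) + c).
  move=> k0 w0 C0; rewrite expRD -!mulrA; congr (_ * _); rewrite !mulrA.
  congr (_ * _).
  rewrite /powR gt_eqF ?divr_gt0// -[C in LHS]lnK ?posrE// -expRD.
  rewrite gt_eqF// !ln_div ?posrE ?mulr_gt0 ?expR_gt0// lnM ?posrE ?expR_gt0//.
  by rewrite expRK; congr expR; field; rewrite gt_eqF.
rewrite !term//.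
set a := u * _; set b := v * _.
have a0 : 0 < a by rewrite mulr_gt0// powR_gt0.
have b0 : 0 < b by rewrite mulr_gt0// powR_gt0.
apply: (@le_trans _ _ (expR (- z) *
    expR (l * (p * ln (l / a) + x) + m * (p * ln (m / b) + y)))); last first.
  by rewrite ler_wpM2l ?expR_ge0// expR_mean_le// ltW.
rewrite -expRD /powR gt_eqF ?addr_gt0// ler_expR.
have := ln_le_relative_entropy l0 m0 lm a0 b0.
by move=> /(ler_wpM2l (ltW p0)); lra.
Qed.

(* The middle factor of the left side is the derivative of r s / (u s + v r)
   along a curve s = s(r) with ds/dr = s'. *)
Lemma harmonic_mean_jacobian (R : realType) (p u v r s s' : R) :
  0 < p -> 0 < u -> 0 < v -> 0 < r -> 0 < s ->
  let D := u * s + v * r in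
  let l := u * s / D in let m := v * r / D in
  (r * s / D) `^ (p - 1) * ((u * s ^+ 2 + v * r ^+ 2 * s') / D ^+ 2) =
  r `^ (p - 1) * (l * (l / u) `^ p) + s `^ (p - 1) * s' * (m * (m / v) `^ p).
Proof.
move=> p0 u0 v0 r0 s0 D l m.
have D0 : 0 < D by rewrite addr_gt0// mulr_gt0.
have lu0 : 0 < l / u by rewrite !divr_gt0// mulr_gt0.
have mv0 : 0 < m / v by rewrite !divr_gt0// mulr_gt0.
(* One factor is split off each [p]-th power. Since [r * (l / u)] and [s * (m / v)] both equal
   [r * s / D], the remaining powers of order [p - 1] coincide and factor out. *)
rewrite -(mulr_powRB1 (ltW lu0) p0) -(mulr_powRB1 (ltW mv0) p0).
have e1 : r `^ (p - 1) * (l / u) `^ (p - 1) = (r * s / D) `^ (p - 1).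
  rewrite -powRM ?ltW//; congr (_ `^ _); rewrite /l; field.
  by rewrite !gt_eqF.
have e2 : s `^ (p - 1) * (m / v) `^ (p - 1) = (r * s / D) `^ (p - 1).
  rewrite -powRM ?ltW//; congr (_ `^ _); rewrite /m; field.
  by rewrite !gt_eqF.
transitivity ((r * s / D) `^ (p - 1) * (l * (l / u)) +
    (r * s / D) `^ (p - 1) * (s' * m * (m / v))); last first.
  by rewrite -{1}e1 -e2; ring.
rewrite -mulrDr; congr (_ * _); rewrite /l /m; field.
by rewrite !gt_eqF.
Qed.

(** * Transport between two rays on compact intervals *)

Lemma ray_density_gt0 (R : realType) (p : R) (phi : R -> R) (s : R) :
  0 < s -> 0 < ray_density p phi s.
Proof. by move=> s0; rewrite mulr_gt0 ?expR_gt0// powR_gt0. Qed.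

Lemma ray_density_continuous (R : realType) (p : R) (phi : R -> R) (s : R) :
  continuous phi -> 0 < s -> {for s, continuous (ray_density p phi)}.
Proof.
move=> cphi s0; apply: cvgM.
  apply: continuous_comp; first exact/continuousN/cphi.
  exact: continuous_expR.
exact: (is_derive1_continuous (is_derive1_powR _ s0)).
Qed.

Lemma measurable_ray_density (R : realType) (p : R) (phi : R -> R) (A : set R) :
  continuous phi -> measurable A -> measurable_fun A (ray_density p phi).
Proof.
move=> cphi mA; apply: measurable_funTS; apply: measurable_funM.
  apply: measurableT_comp; first exact: measurable_expR.
  by apply/measurableT_comp => //; exact: continuous_measurable_fun.
exact: measurable_powR.
Qed.

(** On compact subintervals of the open half-line the densities are continuous and positive, so
    antiderivatives and the mean value theorem can take the place of a change of variables. *)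
Lemma ray_integral_truncated_bound (R : realType) (phi psi chi : R -> R)
    (p u v a b a' b' A B : R) :
  continuous phi -> continuous psi -> continuous chi ->
  0 < p -> 0 < u -> 0 < v -> 0 < a -> a < b -> 0 < a' -> a' < b' ->
  (forall r s : R, 0 < r -> 0 < s ->
    chi (r * s / (u * s + v * r)) <=
    u * s / (u * s + v * r) * phi r + v * r / (u * s + v * r) * psi s) ->
  (\int[lebesgue_measure]_(s in `[a, b]) (ray_density p phi s)%:E = A%:E)%E ->
  (\int[lebesgue_measure]_(s in `[a', b']) (ray_density p psi s)%:E = B%:E)%E ->
  [/\ 0 < A, 0 < B &
  (((u * A `^ (- p^-1) + v * B `^ (- p^-1)) `^ (- p))%:E <=
  \int[lebesgue_measure]_(s in `]0%R, +oo[) (ray_density p chi s)%:E)%E].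
Proof.
move=> cphi cpsi cchi p0 u0 v0 a0 ab a'0 a'b' hchi.
set f := ray_density p phi; set g := ray_density p psi.
set h := ray_density p chi => intA intB.
(* Starting at [c / 2] makes the antiderivative differentiable at the endpoint [c] as well. *)
have anti (w : R -> R) (c : R) : continuous w -> 0 < c -> exists F : R -> R,
    forall x : R, c / 2 < x -> is_derive x 1 F (ray_density p w x).
  move=> cw c0; apply: antiderivative => x cx.
  by apply: ray_density_continuous => //; lra.
have [F dF] := anti phi a cphi a0.
have [G dG] := anti psi a' cpsi a'0.
have defA : A = F b - F a.
  apply: EFin_inj; rewrite -intA; apply: integral_antiderivative => // x /andP[*].
    by apply: ray_density_continuous => //; lra.
  by apply: dF; lra.
have defB : B = G b' - G a'.
  apply: EFin_inj; rewrite -intB; apply: integral_antiderivative => // x /andP[*].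
    by apply: ray_density_continuous => //; lra.
  by apply: dG; lra.
have incF : {in `]a / 2, (b + 1)[ &, {homo F : x y / x < y}}.
  apply: (gt0_is_derive_incr (f := f)) => x /andP[ax _]; first exact: dF.
  by apply: ray_density_gt0; lra.
have dG' x : a' / 2 < x < b' + 1 -> is_derive x 1 G (g x).
  by case/andP => ? _; exact: dG.
have g0 x : a' / 2 < x < b' + 1 -> 0 < g x.
  by case/andP => ? _; apply: ray_density_gt0; lra.
have incG : {in `]a' / 2, (b' + 1)[ &, {homo G : x y / x < y}}.
  exact: gt0_is_derive_incr dG' g0.
have A0 : 0 < A.
  by rewrite defA subr_gt0; apply: incF; rewrite // in_itv/=; apply/andP; split; lra.
have B0 : 0 < B.
  by rewrite defB subr_gt0; apply: incG; rewrite // in_itv/=; apply/andP; split; lra.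
split => //.
have [Ginv GinvP] := is_derive_local_inverse dG' g0.
(* S is the monotone map carrying the probability density f / A on [a, b] to
   the density g / B on [a', b']. *)
pose S r := Ginv (G a' + (F r - F a) * (B / A)).
pose S' r := f r * (B / A) / g (S r).
have FabP r : a <= r <= b -> 0 <= F r - F a <= A.
  move=> /andP[ar rb]; rewrite subr_ge0 defA lerD2r; apply/andP; split.
    move: ar; rewrite le_eqVlt => /predU1P[->//|ar]; apply/ltW/incF => //;
    by rewrite in_itv/=; apply/andP; split; lra.
  move: rb; rewrite le_eqVlt => /predU1P[->//|rb]; apply/ltW/incF => //;
  by rewrite in_itv/=; apply/andP; split; lra.
have SP r : a <= r <= b -> a' <= S r <= b' /\
    is_derive r 1 S (S' r).
  move=> rab; have /andP[F0 FA] := FabP r rab.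
  have BA0 : 0 < B / A by rewrite divr_gt0.
  (* As [F r - F a] runs through [[0, A]], the prescribed value stays between [G a'] and [G b'].
     Hence [S r] is a genuine preimage in [[a', b']], not the default value of [Ginv]. *)
  have [||c cab Gc] := @IVT R G a' b' (G a' + (F r - F a) * (B / A)) (ltW a'b').
  - apply/continuous_in_subspaceT => z; rewrite inE/= in_itv/= => /andP[z1 z2].
    by apply: (is_derive1_continuous (dG z _)); lra.
  - have Gle : G a' <= G b' by rewrite -subr_ge0 -defB ltW.
    rewrite (min_idPl Gle) (max_idPr Gle) lerDl mulr_ge0 ?(ltW BA0)//=.
    rewrite -lerBrDl -defB mulrCA ger_pMr// ler_pdivrMr// mul1r//.
  have c' : a' / 2 < c < b' + 1.
    by move: cab; rewrite in_itv/= => /andP[? ?]; apply/andP; split; lra.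
  have [Gcc dGc] := GinvP c c'.
  have Sr : S r = c by rewrite /S -Gc.
  split; first by rewrite Sr; move: cab; rewrite in_itv/=.
  rewrite /S' Sr.
  have dFr : is_derive r 1 F (f r).
    by apply: dF; move: rab => /andP[? ?]; lra.
  pose L (x : R) := G a' + (F x - F a) * (B / A).
  have dL : is_derive r 1 L (f r * (B / A)).
    have : is_derive r 1 (cst (G a') + (B / A) \*: (F - cst (F a)))
        (0 + (B / A) *: (f r - 0)).
      by apply: is_derive_eq.
    rewrite add0r subr0 [_ *: _]mulrC; congr (is_derive _ _ _ _).
    by apply/funext => x; rewrite /L [RHS]addrC [_ * (B / A)]mulrC addrC.
  have dGc' : is_derive (L r) 1 Ginv (g c)^-1 by rewrite /L -Gc.
  rewrite mulrC; exact: is_derive1_comp.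
(* [T r] is the point [t] on the third ray; [T'] is its derivative in the form required by
   [harmonic_mean_jacobian]. *)
pose T r := r * S r / (u * S r + v * r).
pose T' r := (u * S r ^+ 2 + v * r ^+ 2 * S' r) / (u * S r + v * r) ^+ 2.
have TP r : a <= r <= b ->
    0 < T r /\ is_derive r 1 T (T' r).
  move=> rab; have [/andP[Sa Sb] dS] := SP r rab.
  have r0 : 0 < r by move: rab => /andP[? ?]; lra.
  have s0 : 0 < S r by lra.
  have D0 : 0 < u * S r + v * r by rewrite addr_gt0// mulr_gt0.
  split; first by rewrite divr_gt0// mulr_gt0.
  have dD : is_derive r 1 (u \*: S + v \*: id)
      (u *: S' r + v *: 1).
    by apply: is_derive_eq.
  have dN : is_derive r 1 (id * S)
      (r *: S' r + S r *: 1).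
    by apply: is_derive_eq.
  have dV := @is_deriveV R (u \*: S + v \*: id) r _ 1 (lt0r_neq0 D0) dD.
  apply: (@is_derive_eq _ _ _ T _ _ _ _ (is_deriveM dN dV)).
  rewrite !fctE /= /GRing.scale/= /T'.
  by field; rewrite gt_eqF.
have T'0 r : a <= r <= b -> 0 < T' r.
  move=> rab; have [/andP[Sa Sb] _] := SP r rab.
  have r0 : 0 < r by move: rab => /andP[? ?]; lra.
  have s0 : 0 < S r by lra.
  have fr0 : 0 < f r by exact: ray_density_gt0.
  have gs0 : 0 < g (S r) by exact: ray_density_gt0.
  have S'0 : 0 < S' r.
    by apply: divr_gt0 => //; apply: mulr_gt0 => //; exact: divr_gt0.
  have D0 : 0 < u * S r + v * r by rewrite addr_gt0// mulr_gt0.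
  have n1 : 0 < u * S r ^+ 2 by rewrite mulr_gt0// exprn_gt0.
  have n2 : 0 < v * r ^+ 2 * S' r by rewrite mulr_gt0 // mulr_gt0 // exprn_gt0.
  by rewrite divr_gt0 ?exprn_gt0// addr_gt0.
(* This keeps [T r] in the region where the antiderivative [H] of [h], built from [T a], is
   differentiable. *)
have Tlt r : a < r <= b -> T a < T r.
  move=> /andP[ar rb].
  have [x|x|x] := MVT ar _ _ (f := T) (df := T').
  - by rewrite in_itv/= => /andP[? ?]; apply: (TP x _).2; lra.
  - apply/continuous_in_subspaceT => z; rewrite inE/= in_itv/= => /andP[? ?].
    by apply: (is_derive1_continuous (TP z _).2); lra.
  - rewrite in_itv/= => /andP[? ?] e.
    by rewrite -subr_gt0 e mulr_gt0 ?subr_gt0// T'0//; lra.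
have Tab : T a < T b by rewrite Tlt ?ab/=.
have Ta0 : 0 < T a by apply: (TP a _).1; rewrite lexx ltW.
have [H dH] := anti chi (T a) cchi Ta0.
have dHT r : a <= r <= b -> is_derive (T r) 1 H (h (T r)).
  move=> /andP[]; rewrite le_eqVlt => /predU1P[<- _|ar rb]; apply: dH; first lra.
  have := Tlt r; rewrite ar rb => /(_ isT); lra.
set c := (_ `^ (- p)).
have key : c <= H (T b) - H (T a).
  (* Substitution in differential form: [K' >= 0] says that the pulled back density of [h] dominates
     [c] times the probability density [f / A]. As [F b - F a = A], integrating yields exactly
     [c]. *)
  pose K := H \o T - (c / A) \*: F.
  pose K' r := h (T r) * T' r - c / A * f r.
  have dK r : a <= r <= b -> is_derive r 1 K (K' r).
    move=> rab; apply: is_deriveB.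
      exact: (is_derive1_comp (dHT r rab) (TP r rab).2).
    by apply: is_deriveZ; apply: dF; move: rab => /andP[? ?]; lra.
  have K'0 r : a <= r <= b -> 0 <= K' r.
    move=> rab; have [/andP[Sa Sb] _] := SP r rab.
    have r0 : 0 < r by move: rab => /andP[? ?]; lra.
    have s0 : 0 < S r by lra.
    have D0 : 0 < u * S r + v * r by rewrite addr_gt0// mulr_gt0.
    rewrite /K' subr_ge0 [h _]/h /ray_density -[leRHS]mulrA {2}/T /T'.
    rewrite harmonic_mean_jacobian//.
    set l := u * S r / _; set m := v * r / _.
    have l0 : 0 < l by rewrite divr_gt0// mulr_gt0.
    have m0 : 0 < m by rewrite divr_gt0// mulr_gt0.
    have lm1 : l + m = 1 by rewrite -mulrDl divff// gt_eqF.
    have cle :=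
      pointwise_transport_bound p0 u0 v0 A0 B0 l0 m0 lm1 (hchi _ _ r0 s0).
    have fA0 : 0 <= f r / A by rewrite divr_ge0 ?ltW// ray_density_gt0.
    have -> : c / A * f r = f r / A * c by ring.
    apply: le_trans; first exact: (ler_wpM2l fA0 cle).
    rewrite -/(T r) mulrCA; apply: ler_wpM2l; first exact: expR_ge0.
    (* Equality holds: [f r * expR (phi r)] is [r^(p-1)], and the definition of [S'] turns
       [f r * (B / A) * expR (psi (S r))] into [(S r)^(p-1) * S' r]. *)
    rewrite le_eqVlt; apply/orP; left.
    apply/eqP; rewrite /S' /f /g /ray_density.
    have e0 x : expR x != 0 :> R by rewrite gt_eqF ?expR_gt0.
    have eV x : expR x = (expR (- x))^-1 :> R by rewrite expRN invrK.
    rewrite (eV (phi r)) (eV (psi (S r))).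
    have rp0 : r `^ (p - 1) != 0 by rewrite gt_eqF ?powR_gt0.
    have sp0 : S r `^ (p - 1) != 0 by rewrite gt_eqF ?powR_gt0.
    by field; rewrite !e0 sp0 gt_eqF.
  have [x|x|x] := MVT ab _ _ (f := K) (df := K').
  - by rewrite in_itv/= => /andP[? ?]; apply: dK; lra.
  - apply/continuous_in_subspaceT => z; rewrite inE/= in_itv/= => /andP[? ?].
    by apply: (is_derive1_continuous (dK z _)); lra.
  - rewrite in_itv/= => /andP[? ?] e.
    have : 0 <= K b - K a by rewrite e mulr_ge0 ?K'0// ?subr_ge0 ?ltW//; lra.
    have -> : K b - K a = H (T b) - H (T a) - c / A * (F b - F a).
      by rewrite /K !fctE/= /GRing.scale/=; ring.
    by rewrite -defA divfK ?gt_eqF// subr_ge0.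
(* The increment of [H] is the integral of [h] over [[T a, T b]], which lies in the open half-line
   because [T a > 0]. *)
apply: (@le_trans _ _ (H (T b) - H (T a))%:E); first by rewrite lee_fin.
have <- : (\int[lebesgue_measure]_(s in `[T a, T b]) (h s)%:E =
    (H (T b) - H (T a))%:E)%E.
  apply: integral_antiderivative => // x /andP[? ?].
    by apply: ray_density_continuous => //; lra.
  by apply: dH; lra.
apply: ge0_subset_integral => //=.
- by apply/measurable_EFinP; exact: measurable_ray_density.
- by move=> x; rewrite in_itv/= andbT => x0; rewrite lee_fin ltW// ray_density_gt0.
- by move=> x /=; rewrite !in_itv/= andbT => /andP[? ?]; lra.
Qed.

(** * Exhaustion of the half-line by compact intervals *)

(** The shift by 2 makes the interval nondegenerate already at index 0, where it is [[1/2, 2]]. *)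
Definition truncation (R : realType) (n : nat) : set R :=
  `[n.+2%:R^-1, n.+2%:R].

Lemma truncation_lt (R : realType) (n : nat) : n.+2%:R^-1 < n.+2%:R :> R.
Proof. by apply: (@lt_trans _ _ 1); rewrite ?invf_lt1 ?ltr1n. Qed.

Lemma bigcup_truncation (R : realType) :
  \bigcup_n @truncation R n = `]0%R, +oo[%classic.
Proof.
apply/seteqP; split => [x [n _]|x].
  rewrite /truncation/= !in_itv/= andbT => /andP[+ _].
  by apply: lt_le_trans; rewrite invr_gt0.
rewrite /= in_itv/= andbT => x0.
have [n hn] : exists n, (x <= n%:R) && (x^-1 <= n%:R).
  near \oo => n; exists n; apply/andP; split; near: n; exact: nbhs_infty_ger.
move: hn => /andP[xn xVn].
have nn : n%:R <= n.+2%:R :> R by rewrite ler_nat; exact: leq_trans (leqnSn _).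
exists n => //; rewrite /truncation/= in_itv/= (le_trans xn)// andbT.
by rewrite -(invrK x) lef_pV2 ?posrE ?invr_gt0// (le_trans xVn).
Unshelve. all: by end_near. Qed.

Lemma truncation_nondecreasing (R : realType) : nondecreasing_seq (@truncation R).
Proof.
move=> m n mn; apply/subsetPset => x; rewrite /truncation/= !in_itv/=.
have mn' : m.+2%:R <= n.+2%:R :> R by rewrite ler_nat.
move=> /andP[mx xm]; rewrite (le_trans xm)// andbT.
by rewrite (le_trans _ mx)// lef_pV2 ?posrE.
Qed.

Definition ray_integral (R : realType) (p : R) (phi : R -> R) (A : set R) : \bar R :=
  (\int[lebesgue_measure]_(s in A) (ray_density p phi s)%:E)%E.

(** For [phi s = w (s x)] with [x] nonzero this is the gauge of [w] at [x]. *)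
Definition radial_gauge (R : realType) (p : R) (phi : R -> R) : R :=
  fine (ray_integral p phi `]0%R, +oo[%classic) `^ (- p^-1).

Lemma ray_integral_truncation_cvg (R : realType) (p : R) (phi : R -> R) :
  continuous phi ->
  ray_integral p phi (truncation n) @[n --> \oo] -->
    ray_integral p phi `]0%R, +oo[%classic.
Proof.
move=> cphi; rewrite -bigcup_truncation.
have mT n : measurable (@truncation R n) by exact: measurable_itv.
apply: ge0_nondecreasing_set_cvg_integral => //.
- exact: truncation_nondecreasing.
- by move=> n; apply/measurable_EFinP; exact: measurable_ray_density.
- move=> n x; rewrite /truncation/= in_itv/= => /andP[nx _].
  by rewrite lee_fin ltW// ray_density_gt0// (lt_le_trans _ nx)// invr_gt0.
Qed.

Lemma ray_integral_truncation_fin (R : realType) (p : R) (phi : R -> R) n :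
  continuous phi -> ray_integral p phi (truncation n) \is a fin_num.
Proof.
move=> cphi; apply: integrable_fin_num; first exact: measurable_itv.
apply: continuous_compact_integrable; first exact: segment_compact.
apply/continuous_in_subspaceT => x; rewrite inE /truncation/= in_itv/= => /andP[nx _].
by apply: ray_density_continuous => //; rewrite (lt_le_trans _ nx)// invr_gt0.
Qed.

(* For l = +oo the limit relies on junk values: fine +oo = 0 and 0 `^ (- q) = 0,
   which is the limit one wants. *)
Lemma powRN_cvg_fine (R : realType) (q : R) (I : (\bar R)^nat) (l : \bar R) :
  0 < q -> (forall n, I n \is a fin_num) -> (0 < l)%E ->
  I n @[n --> \oo] --> l ->
  fine (I n) `^ (- q) @[n --> \oo] --> fine l `^ (- q).
Proof.
move=> q0 Ifin; case: l => [l| |] l0 Il; last by rewrite ltNge leNye in l0.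
  apply: (@continuous_cvg _ _ _ _ _ (fine \o I) (fun x => x `^ (- q)) l).
    by apply: is_derive1_continuous; exact: is_derive1_powR.
  exact: fine_cvg.
rewrite /= powR0 ?oppr_eq0 ?gt_eqF//.
apply/cvgr0Pnorm_le => e e0.
(* The threshold solves [I^(-q) = e]. *)
move/cvgeyPge : Il => /(_ (e^-1 `^ q^-1)); apply: filterS => n.
rewrite -[I n](fineK (Ifin n)) lee_fin /= => hn.
rewrite ger0_norm ?powR_ge0// powRN -[e]invrK.
have d0 : 0 < e^-1 `^ q^-1 by rewrite powR_gt0 ?invr_gt0.
have In0 := lt_le_trans d0 hn.
rewrite lef_pV2 ?posrE ?invr_gt0 ?powR_gt0//.
have -> : e^-1 = (e^-1 `^ q^-1) `^ q.
  by rewrite -powRrM mulVf ?gt_eqF// powRr1// ltW ?invr_gt0.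
by rewrite ge0_ler_powR ?nnegrE ?(ltW q0) ?(ltW d0) ?(ltW In0).
Qed.

(** The truncated bound keeps the full integral of [chi], so solving it for the gauge of [chi]
    bounds a fixed number for every [n]; only the right-hand side has to pass to the limit. *)
Lemma radial_gauge_subadditive (R : realType) (phi psi chi : R -> R)
    (p u v : R) :
  continuous phi -> continuous psi -> continuous chi ->
  0 < p -> 0 < u -> 0 < v ->
  (forall r s : R, 0 < r -> 0 < s ->
    chi (r * s / (u * s + v * r)) <=
    u * s / (u * s + v * r) * phi r + v * r / (u * s + v * r) * psi s) ->
  radial_gauge p chi <= u * radial_gauge p phi + v * radial_gauge p psi.
Proof.
move=> cphi cpsi cchi p0 u0 v0 hchi.
pose I w n : R := fine (ray_integral p w (truncation n)).
have IE w n : continuous w -> ray_integral p w (truncation n) = (I w n)%:E.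
  by move=> cw; rewrite fineK// ray_integral_truncation_fin.
have core n := ray_integral_truncated_bound cphi cpsi cchi p0 u0 v0
  (ltac:(by rewrite invr_gt0) : 0 < n.+2%:R^-1 :> R) (truncation_lt R n)
  (ltac:(by rewrite invr_gt0) : 0 < n.+2%:R^-1 :> R) (truncation_lt R n)
  hchi (IE phi n cphi) (IE psi n cpsi).
have le_total w n : continuous w ->
    (ray_integral p w (truncation n) <= ray_integral p w `]0%R, +oo[%classic)%E.
  move=> cw; apply: ge0_subset_integral => //=.
  - exact: measurable_itv.
  - by apply/measurable_EFinP; exact: measurable_ray_density.
  - by move=> x; rewrite in_itv/= andbT => x0; rewrite lee_fin ltW// ray_density_gt0.
  - by rewrite -bigcup_truncation; exact: bigcup_sup.
have gauge_cvg w : continuous w -> (forall n, 0 < I w n) ->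
    I w n `^ (- p^-1) @[n --> \oo] --> radial_gauge p w.
  move=> cw I0; apply: powRN_cvg_fine.
  - by rewrite invr_gt0.
  - by move=> n; exact: ray_integral_truncation_fin.
  - by apply: lt_le_trans (le_total w 0%N cw); rewrite IE// lte_fin.
  - exact: ray_integral_truncation_cvg.
have phi0 n : 0 < I phi n by have [] := core n.
have psi0 n : 0 < I psi n by have [] := core n.
have cvg_rhs : u * I phi n `^ (- p^-1) + v * I psi n `^ (- p^-1) @[n --> \oo] -->
    u * radial_gauge p phi + v * radial_gauge p psi.
  by apply: cvgD; apply: cvgMr; exact: gauge_cvg.
apply: (cvgr_to_ge cvg_rhs); apply: nearW => n.
set X := _ + _.
have X0 : 0 < X by rewrite addr_gt0// mulr_gt0// powR_gt0.
have [_ _] := core n; rewrite -/X -/(ray_integral p chi _) /radial_gauge.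
case: (ray_integral p chi _) => [C| |]//=; rewrite ?lee_fin.
- move=> XC; have d0 : 0 < X `^ (- p) by rewrite powR_gt0.
  have C0 := lt_le_trans d0 XC.
  rewrite powRN -[X]invrK lef_pV2 ?posrE ?invr_gt0 ?powR_gt0//.
  have -> : X^-1 = (X `^ (- p)) `^ p^-1.
    by rewrite -powRrM mulNr mulfV ?gt_eqF// powR_inv1// ltW.
  by rewrite ge0_ler_powR ?nnegrE ?invr_ge0 ?(ltW p0) ?(ltW d0) ?(ltW C0).
(* If the integral for [chi] is infinite, [fine] and the negative power both return 0, so the bound
   is positivity of [X]. *)
- by move=> _; rewrite powR0 ?ltW // lt_eqF // oppr_lt0 invr_gt0.
Qed.

(** * From rays to the vector space *)

Lemma convex_functionP (R : realType) (X : lmodType R) (w : X -> R) :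
  convex_function (setT : set (convex_lmodType X)) w ->
  forall (x y : X) (a b : R), 0 <= a -> 0 <= b -> a + b = 1 ->
  w (a *: x + b *: y) <= a * w x + b * w y.
Proof.
move=> cw x y a b a0 b0 ab.
have a1 : a <= 1 by lra.
have -> : b = 1 - a by lra.
by apply: (cw (Itv01 a0 a1) x y); rewrite in_setT.
Qed.

Lemma ray_gauge_subadditive (R : realType) (X : vectType R) (w : X -> R)
    (p u v : R) (x y : X) :
  convex_function (setT : set (convex_lmodType X)) w ->
  0 < p -> 0 < u -> 0 < v -> x != 0 -> y != 0 ->
  ray_gauge w p (u *: x + v *: y) <= u * ray_gauge w p x + v * ray_gauge w p y.
Proof.
move=> /convex_functionP cw p0 u0 v0 x0 y0.
have gauge0 z : 0 <= ray_gauge w p z.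
  by rewrite /ray_gauge; case: ifP => // _; rewrite powR_ge0.
(* At the origin the gauge is 0 by definition, not by the integral formula, so this case is
   separate. *)
have [->|z0] := eqVneq (u *: x + v *: y) 0.
  by rewrite [leLHS]/ray_gauge eqxx addr_ge0 // mulr_ge0 // ltW.
have cray z : continuous (fun s : R => w (s *: z)).
  apply: convex_continuous => s t a b a0 b0 ab.
  by rewrite scalerDl -!scalerA cw// ltW.
rewrite /ray_gauge (negbTE x0) (negbTE y0) (negbTE z0).
apply: (radial_gauge_subadditive (cray x) (cray y) (cray _)) => // r s r0 s0.
have D0 : 0 < u * s + v * r by rewrite addr_gt0// mulr_gt0.
set l := u * s / _; set m := v * r / _.
(* This identity turns the hypothesis on the three ray functions into convexity of [w] at [r x] and
   [s y]. *)
have -> : (r * s / (u * s + v * r)) *: (u *: x + v *: y) =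
    l *: (r *: x) + m *: (s *: y).
  rewrite scalerDr !scalerA; congr (_ *: _ + _ *: _).
  - by rewrite /l; ring.
  - by rewrite /m; ring.
apply: cw.
- by rewrite ltW// divr_gt0// mulr_gt0.
- by rewrite ltW// divr_gt0// mulr_gt0.
- by rewrite -mulrDl divff// gt_eqF.
Qed.

(* Splitting u x = (u/2) x + (u/2) x yields the scaling bound from subadditivity,
   without a change of variables. *)
Lemma ray_gauge_subhomogeneous (R : realType) (X : vectType R) (w : X -> R)
    (p u : R) (x : X) :
  convex_function (setT : set (convex_lmodType X)) w ->
  0 < p -> 0 < u -> ray_gauge w p (u *: x) <= u * ray_gauge w p x.
Proof.
move=> cw p0 u0.
have [->|x0] := eqVneq x 0; first by rewrite scaler0 /ray_gauge eqxx mulr0.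
have u20 : 0 < u / 2 by rewrite divr_gt0.
have := ray_gauge_subadditive cw p0 u20 u20 x0 x0.
by rewrite -scalerDl -splitr -mulrDl -splitr.
Qed.

Theorem theorem12 (R : realType) (n : nat) (X : vectType R)
    (dimX : \dim {:X} = n)
    (phi : {linear 'rV[R]_n -> X}) (phi_bij : bijective phi)
    (w : X -> R) (w_convex : convex_function (setT : set (convex_lmodType X)) w)
    (w_int : (integral_via phi (fun x => (expR (- w x))%:E) < +oo)%E)
    (p : R) (p_gt0 : 0 < p) :
  convex_function (setT : set (convex_lmodType X)) (ray_gauge w p).
Proof.
move=> t x y _ _.
have [->|t0] := eqVneq t 0%:i01; first by rewrite !conv0.
have [->|t1] := eqVneq t 1%:i01; first by rewrite !conv1.
have u0 : 0 < t%:num by rewrite lt_neqAle eq_sym t0 ge0.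
have v0 : 0 < 1 - t%:num by rewrite subr_gt0 lt_neqAle t1 le1.
suff : ray_gauge w p (t%:num *: (x : X) + (1 - t%:num) *: (y : X)) <=
    t%:num * ray_gauge w p x + (1 - t%:num) * ray_gauge w p y by [].
(* Subadditivity is available for nonzero vectors; if one vector is 0, its gauge vanishes and the
   scaling bound for the other one suffices. *)
have [->|x0] := eqVneq x (0 : X).
  rewrite scaler0 add0r [ray_gauge w p 0]/ray_gauge eqxx mulr0 add0r.
  exact: ray_gauge_subhomogeneous.
have [->|y0] := eqVneq y (0 : X).
  rewrite scaler0 addr0 [ray_gauge w p 0]/ray_gauge eqxx mulr0 addr0.
  exact: ray_gauge_subhomogeneous.
exact: ray_gauge_subadditive.
Qed.
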